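(* Let $\mathbf{k}$ be a commutative unitary ring and let $(A,\ast)$ be an associative $\mathbf{k}$-algebra. (a) Let $(R,\circ,\ell,r)$ be an $A$-bimodule $\mathbf{k}$-algebra, let $\lambda\in\mathbf{k}$, and let $\alpha:R\to A$ be an $\mathcal{O}$-operator on the algebra $R$ of weight $\lambda$. Then the multiplications $$u\prec_\alpha v:=u\,r(\alpha(v)),\qquad u\succ_\alpha v:=\ell(\alpha(u))v,\qquad u\cdot_\alpha v:=\lambda\,u\circ v,\qquad \forall u,v\in R,$$ define a dendriform trialgebra $(R,\prec_\alpha,\succ_\alpha,\cdot_\alpha)$. Further, the multiplication $\star_\alpha:=\prec_\alpha+\succ_\alpha+\cdot_\alpha$ on $R$ defines an associative product on $R$, and the map $\alpha:(R,\star_\alpha)\to(A,\ast)$ is a $\mathbf{k}$-algebra homomorphism. (b) Let $(V,\ell,r)$ be an $A$-bimodule and let $\alpha:V\to A$ be an $\mathcal{O}$-operator on the module $V$. Then the multiplications $$u\prec_\alpha v:=u\,r(\alpha(v)),\qquad u\succ_\alpha v:=\ell(\alpha(u))v,\qquad \forall u,v\in V,$$ define a dendriform dialgebra $(V,\prec_\alpha,\succ_\alpha)$. Further, the multiplication $\star_\alpha:=\prec_\alpha+\succ_\alpha$ on $V$ defines an associative product on $V$, and $\alpha:(V,\star_\alpha)\to(A,\ast)$ is a $\mathbf{k}$-algebra homomorphism.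
   Context: A $\mathbf{k}$-algebra means an associative, not necessarily unitary, $\mathbf{k}$-algebra. Bimodules. For a $\mathbf{k}$-algebra $(A,\ast)$, an $A$-bimodule $(V,\ell,r)$ is a $\mathbf{k}$-module $V$ with $\mathbf{k}$-linear maps $\ell,r:A\to\mathrm{End}_{\mathbf{k}}(V)$, where $r(x)$ is written on the right of its argument ($v\,r(x)$ denotes $r(x)$ applied to $v$), such that for all $x,y\in A$, $v\in V$: $\ell(x\ast y)v=\ell(x)(\ell(y)v)$, $v\,r(x\ast y)=(v\,r(x))\,r(y)$, $(\ell(x)v)\,r(y)=\ell(x)(v\,r(y))$. No unit condition is imposed. An $A$-bimodule $\mathbf{k}$-algebra $(R,\circ,\ell,r)$ is a $\mathbf{k}$-algebra $(R,\circ)$ together with an $A$-bimodule structure $(R,\ell,r)$ such that for all $x\in A$, $v,w\in R$: $\ell(x)(v\circ w)=(\ell(x)v)\circ w$, $(v\circ w)\,r(x)=v\circ(w\,r(x))$, $(v\,r(x))\circ w=v\circ(\ell(x)w)$. $\mathcal{O}$-operators. Given an $A$-bimodule $(V,\ell,r)$, a $\mathbf{k}$-linear map $\alpha:V\to A$ is an $\mathcal{O}$-operator on the module $V$ if $\alpha(u)\ast\alpha(v)=\alpha(\ell(\alpha(u))v)+\alpha(u\,r(\alpha(v)))$ for all $u,v\in V$. Given an $A$-bimodule $\mathbf{k}$-algebra $(R,\circ,\ell,r)$ and $\lambda\in\mathbf{k}$, a $\mathbf{k}$-linear map $\alpha:R\to A$ is an $\mathcal{O}$-operator on the algebra $R$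 of weight $\lambda$ if $\alpha(u)\ast\alpha(v)=\alpha(\ell(\alpha(u))v)+\alpha(u\,r(\alpha(v)))+\lambda\,\alpha(u\circ v)$ for all $u,v\in R$. A dendriform dialgebra is a $\mathbf{k}$-module $D$ with bilinear operations $\prec,\succ$ such that, with $x\star y=x\prec y+x\succ y$, for all $x,y,z\in D$: $(x\prec y)\prec z=x\prec(y\star z)$, $(x\succ y)\prec z=x\succ(y\prec z)$, $x\succ(y\succ z)=(x\star y)\succ z$. A dendriform trialgebra is a $\mathbf{k}$-module $T$ with bilinear operations $\prec,\succ,\cdot$ such that, with $x\star y=x\prec y+x\succ y+x\cdot y$, for all $x,y,z\in T$: $(x\prec y)\prec z=x\prec(y\star z)$, $(x\succ y)\prec z=x\succ(y\prec z)$, $(x\star y)\succ z=x\succ(y\succ z)$, $(x\succ y)\cdot z=x\succ(y\cdot z)$, $(x\prec y)\cdot z=x\cdot(y\succ z)$, $(x\cdot y)\prec z=x\cdot(y\prec z)$, $(x\cdot y)\cdot z=x\cdot(y\cdot z)$. *)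

(* Defs.v *)
From HB Require Import structures.
From mathcomp Require Import all_boot all_algebra.

Set Implicit Arguments.
Unset Strict Implicit.
Unset Printing Implicit Defensive.

Import GRing.Theory.
Local Open Scope ring_scope.

(* The scalars form a [comPzRingType], so the zero ring is allowed; the
   library's [{bilinear _ -> _ -> _}] requires a nonzero ring.  A map
   [A -> End_k(V)] is represented by its uncurried form [f : A -> V -> V]:
   [bilinear_map f] says that each [f a] is an endomorphism and that
   [a |-> f a] is linear. *)
Definition bilinear_map (k : comPzRingType) (U V W : lmodType k)
    (f : U -> V -> W) : Prop :=
  (forall u, linear (f u)) /\ (forall v, linear (f^~ v)).

(* Associative, not necessarily unitary, algebras; the library's [algType]
   structures all have a unit. *)
Record is_algebra (k : comPzRingType) (A : lmodType k)
    (mul : A -> A -> A) : Prop := IsAlgebra {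
  algebra_bilinear : bilinear_map mul;
  algebra_assoc : associative mul
}.

Definition is_algebra_hom (k : comPzRingType) (A B : lmodType k)
    (mulA : A -> A -> A) (mulB : B -> B -> B) (f : A -> B) : Prop :=
  linear f /\ {morph f : x y / mulA x y >-> mulB x y}.

(* The right action [v r(x)] is written [r x v]. *)
Record is_bimodule (k : comPzRingType) (A : lmodType k) (mul : A -> A -> A)
    (V : lmodType k) (l r : A -> V -> V) : Prop := IsBimodule {
  bimodule_l_bilinear : bilinear_map l;
  bimodule_r_bilinear : bilinear_map r;
  bimodule_lM : forall x y v, l (mul x y) v = l x (l y v);
  bimodule_rM : forall x y v, r (mul x y) v = r y (r x v);
  bimodule_lr : forall x y v, r y (l x v) = l x (r y v)
}.

Record is_bimodule_algebra (k : comPzRingType) (A : lmodType k)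
    (mul : A -> A -> A) (R : lmodType k) (circ : R -> R -> R)
    (l r : A -> R -> R) : Prop := IsBimoduleAlgebra {
  bimalg_algebra : is_algebra circ;
  bimalg_bimodule : is_bimodule mul l r;
  bimalg_l : forall x v w, l x (circ v w) = circ (l x v) w;
  bimalg_r : forall x v w, r x (circ v w) = circ v (r x w);
  bimalg_lr : forall x v w, circ (r x v) w = circ v (l x w)
}.

Definition O_operator_module (k : comPzRingType) (A : lmodType k)
    (mul : A -> A -> A) (V : lmodType k) (l r : A -> V -> V)
    (alpha : {linear V -> A}) : Prop :=
  forall u v : V,
    mul (alpha u) (alpha v) = alpha (l (alpha u) v) + alpha (r (alpha v) u).

Definition O_operator_algebra (k : comPzRingType) (A : lmodType k)
    (mul : A -> A -> A) (R : lmodType k) (circ : R -> R -> R)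
    (l r : A -> R -> R) (lambda : k) (alpha : {linear R -> A}) : Prop :=
  forall u v : R,
    mul (alpha u) (alpha v) =
      alpha (l (alpha u) v) + alpha (r (alpha v) u)
      + lambda *: alpha (circ u v).

Definition star2 (k : comPzRingType) (D : lmodType k)
    (prec succ : D -> D -> D) : D -> D -> D :=
  fun x y => prec x y + succ x y.

Definition star3 (k : comPzRingType) (T : lmodType k)
    (prec succ dot : T -> T -> T) : T -> T -> T :=
  fun x y => prec x y + succ x y + dot x y.

Record is_dendriform_dialgebra (k : comPzRingType) (D : lmodType k)
    (prec succ : D -> D -> D) : Prop := IsDendriformDialgebra {
  dialg_prec_bilinear : bilinear_map prec;
  dialg_succ_bilinear : bilinear_map succ;
  dialg_pp : forall x y z,
    prec (prec x y) z = prec x (star2 prec succ y z);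
  dialg_sp : forall x y z, prec (succ x y) z = succ x (prec y z);
  dialg_ss : forall x y z,
    succ x (succ y z) = succ (star2 prec succ x y) z
}.

Record is_dendriform_trialgebra (k : comPzRingType) (T : lmodType k)
    (prec succ dot : T -> T -> T) : Prop := IsDendriformTrialgebra {
  trialg_prec_bilinear : bilinear_map prec;
  trialg_succ_bilinear : bilinear_map succ;
  trialg_dot_bilinear : bilinear_map dot;
  trialg_pp : forall x y z,
    prec (prec x y) z = prec x (star3 prec succ dot y z);
  trialg_sp : forall x y z, prec (succ x y) z = succ x (prec y z);
  trialg_ss : forall x y z,
    succ (star3 prec succ dot x y) z = succ x (succ y z);
  trialg_sd : forall x y z, dot (succ x y) z = succ x (dot y z);
  trialg_pd : forall x y z, dot (prec x y) z = dot x (succ y z);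
  trialg_dp : forall x y z, prec (dot x y) z = dot x (prec y z);
  trialg_dd : forall x y z, dot (dot x y) z = dot x (dot y z)
}.

Definition prec_of (k : comPzRingType) (A V : lmodType k)
    (r : A -> V -> V) (alpha : V -> A) : V -> V -> V :=
  fun u v => r (alpha v) u.

Definition succ_of (k : comPzRingType) (A V : lmodType k)
    (l : A -> V -> V) (alpha : V -> A) : V -> V -> V :=
  fun u v => l (alpha u) v.

Definition dot_of (k : comPzRingType) (R : lmodType k)
    (circ : R -> R -> R) (lambda : k) : R -> R -> R :=
  fun u v => lambda *: circ u v.

(* Main.v *)
Require Import Defs.
From HB Require Import structures.
From mathcomp Require Import all_boot all_algebra.

Set Implicit Arguments.
Unset Strict Implicit.
Unset Printing Implicit Defensive.

Import GRing.Theory.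
Local Open Scope ring_scope.

(** The operator identity says exactly that [alpha] sends
    [u star v = u r(alpha v) + l(alpha u) v + lambda (u circ v)] to
    [alpha u * alpha v] ([alpha_star3]).  In the trialgebra
    axioms, [star] only ever occurs as the argument of [alpha]
    inside an action of [A], where it may be replaced by the product of [A],
    and the compatibility axioms of a bimodule algebra then finish.

    Associativity of [star] holds in every trialgebra: expand the outer [star]
    by its definition, and the inner one except in [(x star y) succ z] and
    [x prec (y star z)].  Then [(x star y) star z] and
    [x star (y star z)] are sums of seven terms each, and the seven trialgebra
    axioms match these terms one to one ([trialgebra_star_algebra]).  Arguing
    through [alpha] would only give associativity modulo its kernel.

    The module case is the algebra case for the zero product: a bimodule with
    zero product is a bimodule algebra, an operator on the module is an operator
    of weight [0] on it, and a trialgebra whose third operation vanishes is a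
    dialgebra. *)

Section BilinearMap.
Variables (k : comPzRingType) (U V W : lmodType k).
Implicit Types f g : U -> V -> W.

Lemma bilinear_mapDl f : bilinear_map f ->
  forall u1 u2 v, f (u1 + u2) v = f u1 v + f u2 v.
Proof. by case=> _ fl u1 u2 v; have := fl v 1 u1 u2; rewrite !scale1r. Qed.

Lemma bilinear_mapDr f : bilinear_map f ->
  forall u v1 v2, f u (v1 + v2) = f u v1 + f u v2.
Proof. by case=> fr _ u v1 v2; have := fr u 1 v1 v2; rewrite !scale1r. Qed.

Lemma bilinear_map0l f : bilinear_map f -> forall v, f 0 v = 0.
Proof.
by move=> fB v; apply: (addrI (f 0 v)); rewrite -(bilinear_mapDl fB) !addr0.
Qed.

Lemma bilinear_map0r f : bilinear_map f -> forall u, f u 0 = 0.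
Proof.
by move=> fB u; apply: (addrI (f u 0)); rewrite -(bilinear_mapDr fB) !addr0.
Qed.

Lemma bilinear_mapZl f : bilinear_map f ->
  forall a u v, f (a *: u) v = a *: f u v.
Proof.
move=> fB a u v; have f0 := bilinear_map0l fB v.
by case: fB => _ fl; have := fl v a u 0; rewrite /= f0 !addr0.
Qed.

Lemma bilinear_mapZr f : bilinear_map f ->
  forall a u v, f u (a *: v) = a *: f u v.
Proof.
move=> fB a u v; have f0 := bilinear_map0r fB u.
by case: fB => fr _; have := fr u a v 0; rewrite /= f0 !addr0.
Qed.

Lemma bilinear_map0 : bilinear_map (fun (_ : U) (_ : V) => 0 : W).
Proof. by split=> [u | v] a x y /=; rewrite scaler0 addr0. Qed.

Lemma bilinear_map_add f g : bilinear_map f -> bilinear_map g ->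
  bilinear_map (fun u v => f u v + g u v).
Proof.
move=> [fr fl] [gr gl]; split=> [u | v] a x y.
  by rewrite fr gr scalerDr addrACA.
by have /= -> := fl v a x y; have /= -> := gl v a x y; rewrite scalerDr addrACA.
Qed.

Lemma bilinear_map_scale c f : bilinear_map f ->
  bilinear_map (fun u v => c *: f u v).
Proof.
move=> [fr fl]; split=> [u | v] a x y.
  by rewrite fr scalerDr !scalerA mulrC.
by have /= -> := fl v a x y; rewrite scalerDr !scalerA mulrC.
Qed.

Lemma bilinear_map_flip f : bilinear_map f -> bilinear_map (fun v u => f u v).
Proof. by case. Qed.

Lemma bilinear_map_compl (U' : lmodType k) (h : {linear U' -> U}) f :
  bilinear_map f -> bilinear_map (fun u v => f (h u) v).
Proof.
move=> [fr fl]; split=> [u | v] a x y; first exact: fr.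
by rewrite linearP; have /= -> := fl v a (h x) (h y).
Qed.

Lemma eq_bilinear_map f g : f =2 g -> bilinear_map f -> bilinear_map g.
Proof.
by move=> fg [fr fl]; split=> [u | v] a x y; rewrite -!fg; [apply: fr | apply: fl].
Qed.

End BilinearMap.

Lemma eq_is_algebra (k : comPzRingType) (A : lmodType k)
    (mul mul' : A -> A -> A) :
  mul =2 mul' -> is_algebra mul -> is_algebra mul'.
Proof.
move=> eqm [mulB mulA]; split; first exact: eq_bilinear_map mulB.
by move=> x y z; rewrite -!eqm mulA.
Qed.

Lemma trialgebra_star_algebra (k : comPzRingType) (T : lmodType k)
    (prec succ dot : T -> T -> T) :
  is_dendriform_trialgebra prec succ dot -> is_algebra (star3 prec succ dot).
Proof.
move=> [pB sB dB pp sp ss sd pd dp dd]; split.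
  exact: bilinear_map_add (bilinear_map_add pB sB) dB.
move=> x y z.
(* The right-hand side lists the left-hand sides of the seven axioms, grouped
   so that after rewriting with the axioms each parenthesis is
   [succ x (y star z)] or [dot x (y star z)]. *)
have -> : star3 prec succ dot x (star3 prec succ dot y z) =
    prec (prec x y) z
    + (prec (succ x y) z + succ (star3 prec succ dot x y) z + dot (succ x y) z)
    + (prec (dot x y) z + dot (prec x y) z + dot (dot x y) z).
  rewrite pp sp ss sd dp pd dd [LHS]/star3 -!(bilinear_mapDr sB).
  by rewrite -!(bilinear_mapDr dB).
rewrite [RHS]/star3 (bilinear_mapDl pB) (bilinear_mapDl pB).
rewrite (bilinear_mapDl dB) (bilinear_mapDl dB).
by rewrite [RHS](AC (3*1*3) (1*(2*4*6)*(3*5*7))).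
Qed.

Section OperatorAlgebra.
Variables (k : comPzRingType) (A : lmodType k) (mul : A -> A -> A).
Variables (R : lmodType k) (circ : R -> R -> R) (l r : A -> R -> R).
Variables (lambda : k) (alpha : {linear R -> A}).
Hypothesis R_bimalg : is_bimodule_algebra mul circ l r.
Hypothesis alphaO : O_operator_algebra mul circ l r lambda alpha.

Let prec := prec_of r alpha.
Let succ := succ_of l alpha.
Let dot := dot_of circ lambda.

Lemma alpha_star3 u v : alpha (star3 prec succ dot u v) = mul (alpha u) (alpha v).
Proof.
by rewrite alphaO /star3 !linearD linearZ /= [alpha (prec u v) + _]addrC.
Qed.

Lemma operator_trialgebra : is_dendriform_trialgebra prec succ dot.
Proof.
case: R_bimalg => -[cB cA] [lB rB lM rM lr] lc rc crl.
split.
- exact/bilinear_map_flip/(bilinear_map_compl alpha rB).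
- exact: bilinear_map_compl.
- exact: bilinear_map_scale.
- move=> x y z; rewrite -[RHS]/(r (alpha (star3 prec succ dot y z)) x).
  by rewrite alpha_star3 rM.
- by move=> x y z; apply: lr.
- move=> x y z; rewrite -[LHS]/(l (alpha (star3 prec succ dot x y)) z).
  by rewrite alpha_star3 lM.
- move=> x y z; rewrite /dot /succ /dot_of /succ_of.
  by rewrite (bilinear_mapZr lB) lc.
- by move=> x y z; rewrite /dot /dot_of crl.
- move=> x y z; rewrite /dot /prec /dot_of /prec_of.
  by rewrite (bilinear_mapZr rB) rc.
- move=> x y z; rewrite /dot /dot_of.
  by rewrite (bilinear_mapZl cB) (bilinear_mapZr cB) cA.
Qed.

Lemma operator_algebra_hom : is_algebra_hom (star3 prec succ dot) mul alpha.
Proof. by split; [apply: linearP | apply: alpha_star3]. Qed.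

End OperatorAlgebra.

Lemma bimodule_zero_algebra (k : comPzRingType) (A : lmodType k)
    (mul : A -> A -> A) (V : lmodType k) (l r : A -> V -> V) :
  is_bimodule mul l r -> is_bimodule_algebra mul (fun _ _ => 0) l r.
Proof.
move=> V_bimod; case: (V_bimod) => lB rB _ _ _; split=> //.
- by split=> //; apply: bilinear_map0.
- by move=> x _ _; rewrite (bilinear_map0r lB).
- by move=> x _ _; rewrite (bilinear_map0r rB).
Qed.

Lemma star3_dot0 (k : comPzRingType) (D : lmodType k)
    (prec succ dot : D -> D -> D) :
  (forall x y, dot x y = 0) -> star3 prec succ dot =2 star2 prec succ.
Proof. by move=> dot0 x y; rewrite /star3 dot0 addr0. Qed.

Lemma trialgebra_dot0_dialgebra (k : comPzRingType) (D : lmodType k)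
    (prec succ dot : D -> D -> D) : (forall x y, dot x y = 0) ->
  is_dendriform_trialgebra prec succ dot -> is_dendriform_dialgebra prec succ.
Proof.
move=> dot0 [pB sB _ pp sp ss _ _ _ _]; split=> // x y z.
  by rewrite pp star3_dot0.
by rewrite -ss star3_dot0.
Qed.

Theorem theorem2p7 (k : comPzRingType) (A : lmodType k) (mul : A -> A -> A)
    (hA : is_algebra mul) :
  (forall (R : lmodType k) (circ : R -> R -> R) (l r : A -> R -> R)
      (lambda : k) (alpha : {linear R -> A}),
    is_bimodule_algebra mul circ l r ->
    O_operator_algebra mul circ l r lambda alpha ->
    let prec := prec_of r alpha in
    let succ := succ_of l alpha in
    let dot := dot_of circ lambda in
    [/\ is_dendriform_trialgebra prec succ dot,
        is_algebra (star3 prec succ dot)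
      & is_algebra_hom (star3 prec succ dot) mul alpha]) /\
  (forall (V : lmodType k) (l r : A -> V -> V) (alpha : {linear V -> A}),
    is_bimodule mul l r ->
    O_operator_module mul l r alpha ->
    let prec := prec_of r alpha in
    let succ := succ_of l alpha in
    [/\ is_dendriform_dialgebra prec succ,
        is_algebra (star2 prec succ)
      & is_algebra_hom (star2 prec succ) mul alpha]).
Proof.
split=> [R circ l r lambda alpha R_bimalg alphaO | V l r alpha V_bimod alphaO]
  prec succ.
  move=> dot; have T := operator_trialgebra R_bimalg alphaO.
  split=> //; first exact: trialgebra_star_algebra.
  exact: operator_algebra_hom.
have V_bimalg := bimodule_zero_algebra V_bimod.
have alphaO0 : O_operator_algebra mul (fun _ _ => 0) l r 0 alpha.
  by move=> u v; rewrite scale0r addr0.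
have dot0 x y : dot_of (fun _ _ : V => 0) 0 x y = 0 by apply: scale0r.
have T := operator_trialgebra V_bimalg alphaO0.
have starE := star3_dot0 prec succ dot0.
split; first exact: trialgebra_dot0_dialgebra T.
  exact: eq_is_algebra starE (trialgebra_star_algebra T).
case: (operator_algebra_hom alphaO0) => alphaL alphaM.
by split=> // u v; rewrite -starE alphaM.
Qed.
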